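(* Let $\chi\in\mathcal U$ and suppose $\lambda>1/2$. Then $$\min_{(\hat\sigma,\hat\varrho)\in S}L(\chi,\hat\sigma,\hat\varrho)=\tilde J(\chi,\sigma^*,\varrho^* ),$$ where $(\sigma^*,\varrho^* )\in\arg\min_{(\hat\sigma,\hat\varrho)\in S}\tilde g(\chi,\hat\sigma,\hat\varrho)$.
   Context: $\Omega\subset\mathbb R^d$ is a bounded Lipschitz domain with $\partial\Omega=\bar\Gamma_D\cup\bar\Gamma_N$, $\Gamma_D\cap\Gamma_N=\emptyset$, and $\Gamma_D$ of positive surface measure. $q_{\rm in},q_{\rm out}\in L^2(\Gamma_N)$ are given ($\mathbb R^d$-valued) boundary forces. $H_D^1(\Omega)^d=\{v\in H^1(\Omega)^d: v=0\text{ on }\Gamma_D\}$, and $\varepsilon(u)=\frac12(\nabla u+\nabla u^{T})$. $E_0$ is a constant elasticity tensor (symmetric and positive definite on symmetric $d\times d$ matrices), and $E_{\max},E_{\min}>0$ are constants. For $\beta\in(0,1)$, $$\mathcal U=\Big\{\chi\in BV(\Omega):\chi\in\{0,1\},\ \int_\Omega\chi\,dx\le\beta|\Omega|\Big\}.$$ For $\chi\in\mathcal U$: $E^{-1}(\chi)=\big(\big(\frac1{E_{\max}}-\frac1{E_{\min}}\big)\chi+\frac1{E_{\min}}\big)E_0^{-1}$. The expression $E^{-1}(\chi)\sigma:\varrho$ means $(E^{-1}(\chi)\sigma):\varrho$, with $:$ the Frobenius product. $S$ is the set of pairs $(\sigma,\varrho)\in (L^2(\Omega)^{d\times d})^2$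 of symmetric matrix fields with $\nabla\cdot\sigma=0$, $\nabla\cdot\varrho=0$ in $\Omega$ and $\sigma\cdot\vec n=q_{\rm in}$, $\varrho\cdot\vec n=q_{\rm out}$ on $\Gamma_N$ (in the usual weak sense), i.e. $\int_\Omega\sigma:\varepsilon(w)\,dx=\int_{\Gamma_N}q_{\rm in}\cdot w\,ds$ and $\int_\Omega\varrho:\varepsilon(w)\,dx=\int_{\Gamma_N}q_{\rm out}\cdot w\,ds$ for all $w\in H_D^1(\Omega)^d$. Define $$\tilde J(\chi,\sigma,\varrho)=\int_\Omega E^{-1}(\chi)\sigma:\varrho\,dx,\qquad \tilde g(\chi,\sigma,\varrho)=\int_\Omega E^{-1}(\chi)(\sigma:\sigma+\varrho:\varrho)\,dx,$$ $$L(\chi,\sigma,\varrho)=\tilde J(\chi,\sigma,\varrho)+\lambda\Big(\tilde g(\chi,\sigma,\varrho)-\min_{(\hat\sigma,\hat\varrho)\in S}\tilde g(\chi,\hat\sigma,\hat\varrho)\Big),$$ with penalty parameter $\lambda>0$. *)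

(* Defs.v *)
From HB Require Import structures.
From mathcomp Require Import all_boot all_order all_algebra.
From mathcomp Require Import all_classical all_reals all_analysis.

Set Implicit Arguments.
Unset Strict Implicit.
Unset Printing Implicit Defensive.
Import Order.TTheory GRing.Theory Num.Theory.
Import numFieldNormedType.Exports.

Local Open Scope classical_set_scope.
Local Open Scope ring_scope.

(* A copy of T in which every set is measurable: [mu_ext] over this copy is
   the outer measure generated by an arbitrary gauge on all subsets of T. *)
Definition all_measurable (T : Type) : Type := T.

Section all_measurable_structure.
Variable T : pointedType.

Let all0 : [set: set (all_measurable T)] set0. Proof. by []. Qed.
Let allC (A : set (all_measurable T)) :
  [set: set (all_measurable T)] A -> [set: set (all_measurable T)] (~` A).
Proof. by []. Qed.
Let allU (F : (set (all_measurable T))^nat) :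
  (forall i, [set: set (all_measurable T)] (F i)) ->
  [set: set (all_measurable T)] (\bigcup_i F i).
Proof. by []. Qed.

HB.instance Definition _ := Pointed.on (all_measurable T).
HB.instance Definition _ := @isMeasurable.Build default_measure_display
  (all_measurable T) [set: set (all_measurable T)] all0 allC allU.

End all_measurable_structure.

Section euclidean.
Variable R : realType.

Definition dot (d : nat) (x y : 'rV[R]_d) : R := \sum_i x 0 i * y 0 i.
Definition enorm (d : nat) (x : 'rV[R]_d) : R := Num.sqrt (dot x x).
Definition frob (d : nat) (A B : 'M[R]_d) : R := \sum_i \sum_j A i j * B i j.

End euclidean.

Section lebesgue.
Variables (R : realType) (d : nat).
Local Open Scope ereal_scope.

(* Least volume of a closed box containing U.  The empty set is singled out
   because a box in R^0 has volume 1. *)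
Definition box_gauge (U : set (all_measurable 'rV[R]_d)) : \bar R :=
  if `[< U = set0 >] then 0 else
  ereal_inf [set v | exists a b : 'rV[R]_d,
    [/\ forall i, (a 0 i <= b 0 i)%R,
        U `<=` [set x | forall i, (a 0 i <= x 0 i <= b 0 i)%R] &
        v = (\prod_i (b 0 i - a 0 i))%:E]].

Lemma box_gauge0 : box_gauge set0 = 0.
Proof. by rewrite /box_gauge; case: asboolP. Qed.

Lemma box_gauge_ge0 U : 0 <= box_gauge U.
Proof.
rewrite /box_gauge; case: asboolP => // _.
apply: le_ereal_inf_tmp => _ [a [b [ab _ ->]]].
by rewrite lee_fin prodr_ge0 // => i _; rewrite subr_ge0.
Qed.

Definition lebesgue_outer (A : set 'rV[R]_d) : \bar R :=
  mu_ext box_gauge (A : set (all_measurable 'rV[R]_d)).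

HB.instance Definition _ := isOuterMeasure.Build R 'rV[R]_d lebesgue_outer
  (mu_ext0 box_gauge0 box_gauge_ge0)
  (mu_ext_ge0 box_gauge_ge0)
  (@le_mu_ext _ _ _ box_gauge)
  (mu_ext_sigma_subadditive box_gauge_ge0).

(* d-dimensional Lebesgue measure on the Lebesgue measurable sets. *)
Definition leb : {measure set (caratheodory_type lebesgue_outer) -> \bar R} :=
  (lebesgue_outer : outer_measure R 'rV[R]_d).

End lebesgue.
Arguments leb {R d}.

Section hausdorff.
Variables (R : realType) (d s : nat).
Local Open Scope ereal_scope.

Definition unit_ball_volume : R :=
  fine (lebesgue_outer [set x : 'rV[R]_s | (enorm x <= 1)%R]).

Definition diam (U : set 'rV[R]_d) : \bar R :=
  ereal_sup [set (enorm (x - y))%:E | x in U & y in U].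

Definition diam_gauge (delta : R) (U : set (all_measurable 'rV[R]_d)) : \bar R :=
  if `[< U = set0 >] then 0 else
  if diam U <= delta%:E
  then (unit_ball_volume * (fine (diam U) / 2) ^+ s)%:E else +oo.

Lemma diam_gauge0 delta : diam_gauge delta set0 = 0.
Proof. by rewrite /diam_gauge; case: asboolP. Qed.

Lemma diam_gauge_ge0 delta U : 0 <= diam_gauge delta U.
Proof.
rewrite /diam_gauge; case: asboolP => // U0; case: ifP => // _.
rewrite lee_fin mulr_ge0 //; first by rewrite fine_ge0 // outer_measure_ge0.
rewrite exprn_ge0 // divr_ge0 // fine_ge0 //.
have /set0P[x Ux] : U != set0 by apply/eqP.
apply: (@le_trans _ _ (enorm (x - x))%:E); first by rewrite lee_fin sqrtr_ge0.
by apply: ereal_sup_ubound; exists x => //; exists x.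
Qed.

(* s-dimensional Hausdorff measure, normalized to agree with Lebesgue measure
   when s = d. *)
Definition hausdorff_outer (A : set 'rV[R]_d) : \bar R :=
  ereal_sup [set mu_ext (diam_gauge delta) (A : set (all_measurable 'rV[R]_d)) |
    delta in [set delta | (0 < delta)%R]].

Let le_hausdorff A delta : (0 < delta)%R ->
  mu_ext (diam_gauge delta) (A : set (all_measurable 'rV[R]_d)) <= hausdorff_outer A.
Proof. by move=> delta0; apply: ereal_sup_ubound; exists delta. Qed.

Let hausdorff_outer_ge0 A : 0 <= hausdorff_outer A.
Proof.
exact: le_trans (mu_ext_ge0 (diam_gauge_ge0 1) A) (le_hausdorff A ltr01).
Qed.

Let hausdorff_outer0 : hausdorff_outer set0 = 0.
Proof.
apply/eqP; rewrite eq_le hausdorff_outer_ge0 andbT.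
apply: ge_ereal_sup => _ [delta _ <-].
by rewrite (mu_ext0 (diam_gauge0 delta) (diam_gauge_ge0 delta)).
Qed.

Let le_hausdorff_outer : {homo hausdorff_outer : A B / A `<=` B >-> A <= B}.
Proof.
move=> A B AB; apply: ge_ereal_sup => _ [delta delta0 <-].
apply: le_trans (le_hausdorff B delta0).
exact: (@le_mu_ext _ (all_measurable 'rV[R]_d) R (diam_gauge delta)).
Qed.

Let hausdorff_sigma_subadditive : sigma_subadditive hausdorff_outer.
Proof.
move=> F; apply: ge_ereal_sup => _ [delta delta0 <-].
apply: le_trans (mu_ext_sigma_subadditive (diam_gauge_ge0 delta) F) _.
apply: lee_nneseries => i _; last exact: le_hausdorff.
by move=> _; exact: (mu_ext_ge0 (diam_gauge_ge0 delta)).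
Qed.

HB.instance Definition _ := isOuterMeasure.Build R 'rV[R]_d hausdorff_outer
  hausdorff_outer0 hausdorff_outer_ge0 le_hausdorff_outer
  hausdorff_sigma_subadditive.

End hausdorff.

(* Surface measure on hypersurfaces of R^d. *)
Definition surf {R : realType} {d : nat} :
    {measure set (caratheodory_type (@hausdorff_outer R d d.-1)) -> \bar R} :=
  (@hausdorff_outer R d d.-1 : outer_measure R 'rV[R]_d).

Section function_spaces.
Variables (R : realType) (d : nat).
Notation V := 'rV[R]_d.
Implicit Types (Omega : set V) (u phi : V -> R).

(* f belongs to Lp(D): its extension by zero outside D is in the library's Lp. *)
Definition in_Lp disp (T : measurableType disp)
    (mu : {measure set T -> \bar R}) (p : \bar R) (D : set T) (f : T -> R) :=
  f \_ D \in Lfun mu p.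

Definition partial (i : 'I_d) phi : V -> R := fun x => 'D_(delta_mx 0 i) phi x.

Definition iter_partial (s : seq 'I_d) phi : V -> R := foldr partial phi s.

Definition Cn (n : nat) phi :=
  (forall s, (size s <= n)%N -> continuous (iter_partial s phi)) /\
  (forall s i x, (size s < n)%N ->
     derivable (iter_partial s phi) x (delta_mx 0 i)).

Definition smooth phi := forall n, Cn n phi.

Definition compact_support_in Omega phi :=
  compact (closure [set x | phi x != 0]) /\
  closure [set x | phi x != 0] `<=` Omega.

Definition is_weak_grad Omega u (g : V -> V) :=
  forall j, in_Lp leb 2%:E Omega (fun x => g x 0 j) /\
    forall phi, smooth phi -> compact_support_in Omega phi ->
      \int[leb]_(x in Omega) (u x * partial j phi x) =
      - \int[leb]_(x in Omega) (g x 0 j * phi x).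

Definition H1 Omega : set (V -> R) :=
  [set u | in_Lp leb 2%:E Omega u /\ exists g, is_weak_grad Omega u g].

(* The a.e. unique weak gradient of u in H1. *)
Definition weak_grad Omega u : V -> V :=
  xget (fun=> 0) [set g | is_weak_grad Omega u g].

Definition bdry (A : set V) : set V := closure A `\` interior A.

(* t is the boundary trace of u in H1: the L2(bdry Omega) limit of the boundary
   values of smooth functions converging to u in H1(Omega). *)
Definition is_trace Omega u (t : V -> R) :=
  in_Lp surf 2%:E (bdry Omega) t /\
  exists phi : nat -> V -> R, [/\ forall n, smooth (phi n),
    (\int[leb]_(x in Omega) ((phi n x - u x) ^+ 2)%:E)%E
      @[n --> \oo] --> 0%E,
    forall j, (\int[leb]_(x in Omega)
        ((partial j (phi n) x - weak_grad Omega u x 0 j) ^+ 2)%:E)%E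
      @[n --> \oo] --> 0%E &
    (\int[surf]_(x in bdry Omega) ((phi n x - t x) ^+ 2)%:E)%E
      @[n --> \oo] --> 0%E].

Definition trace Omega u : V -> R :=
  xget (fun=> 0) [set t | is_trace Omega u t].

Definition BV Omega : set (V -> R) :=
  [set u | in_Lp leb 1%E Omega u /\
    exists M : R, forall phi : V -> V,
      (forall i, Cn 1 (fun x => phi x 0 i) /\
                 compact_support_in Omega (fun x => phi x 0 i)) ->
      (forall x, enorm (phi x) <= 1) ->
      \int[leb]_(x in Omega)
        (u x * \sum_i partial i (fun y => phi y 0 i) x) <= M].

Definition component (w : V -> V) (i : 'I_d) : V -> R := fun x => w x 0 i.

Definition L2vec disp (T : measurableType disp)
    (mu : {measure set T -> \bar R}) (D : set T) (q : T -> V) :=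
  forall i, in_Lp mu 2%:E D (fun x => q x 0 i).

Definition L2mx Omega (s : V -> 'M[R]_d) :=
  forall i j, in_Lp leb 2%:E Omega (fun x => s x i j).

Definition jacobian_mx Omega (w : V -> V) (x : V) : 'M[R]_d :=
  \matrix_(i, j) weak_grad Omega (component w i) x 0 j.

Definition strain Omega (w : V -> V) (x : V) : 'M[R]_d :=
  2^-1 *: (jacobian_mx Omega w x + (jacobian_mx Omega w x)^T).

Definition trace_vec Omega (w : V -> V) (x : V) : V :=
  \row_i trace Omega (component w i) x.

Definition H1D Omega (GammaD : set V) : set (V -> V) :=
  [set w | (forall i, H1 Omega (component w i)) /\
    {ae surf, forall x, GammaD x -> trace_vec Omega w x = 0}].

(* Near each boundary point, Omega is the part of a ball lying strictly above
   (in the direction of a unit vector e) the graph of a Lipschitz function over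
   the hyperplane orthogonal to e. *)
Definition lipschitz_boundary Omega :=
  forall x0, bdry Omega x0 ->
  exists (r K : R) (e : V) (gamma : V -> R),
    [/\ 0 < r, dot e e = 1,
        forall x y, `|gamma x - gamma y| <= K * enorm (x - y) &
        forall x, enorm (x - x0) < r ->
          (Omega x <-> gamma (x - dot x e *: e) < dot x e)].

Definition bounded_lipschitz_domain Omega :=
  [/\ open Omega, connected Omega, Omega !=set0, bounded_set Omega &
      lipschitz_boundary Omega].

End function_spaces.

Section elasticity.
Variables (R : realType) (d : nat).
Notation V := 'rV[R]_d.
Notation M := 'M[R]_d.

Definition symmetric_mx (A : M) := A^T = A.

Definition elasticity_tensor (E0 : {linear M -> M}) :=
  [/\ forall A, symmetric_mx A -> symmetric_mx (E0 A),
      forall A B, symmetric_mx A -> symmetric_mx B ->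
        frob (E0 A) B = frob A (E0 B) &
      forall A, symmetric_mx A -> A != 0 -> 0 < frob (E0 A) A].

(* Inverse of E0 as an operator on symmetric matrices. *)
Definition tensor_inv (E0 : {linear M -> M}) (A : M) : M :=
  xget 0 [set B | symmetric_mx B /\ E0 B = A].

Definition designs (Omega : set V) (beta : R) : set (V -> R) :=
  [set chi | [/\ BV Omega chi,
    {ae leb, forall x, Omega x -> chi x = 0 \/ chi x = 1} &
    \int[leb]_(x in Omega) chi x <= beta * fine (leb Omega)]].

Definition stress_pairs (Omega GammaD GammaN : set V) (qin qout : V -> V) :
    set ((V -> M) * (V -> M)) :=
  [set p | [/\ L2mx Omega p.1, L2mx Omega p.2,
    {ae leb, forall x, Omega x -> symmetric_mx (p.1 x)},
    {ae leb, forall x, Omega x -> symmetric_mx (p.2 x)} &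
    forall w, H1D Omega GammaD w ->
      \int[leb]_(x in Omega) frob (p.1 x) (strain Omega w x) =
        \int[surf]_(x in GammaN) dot (qin x) (trace_vec Omega w x) /\
      \int[leb]_(x in Omega) frob (p.2 x) (strain Omega w x) =
        \int[surf]_(x in GammaN) dot (qout x) (trace_vec Omega w x)]].

Section functionals.
Variables (E0 : {linear M -> M}) (Emax Emin : R) (Omega : set V).
Implicit Types (chi : V -> R) (p : (V -> M) * (V -> M)).

Definition Einv chi (x : V) (A : M) : M :=
  ((Emax^-1 - Emin^-1) * chi x + Emin^-1) *: tensor_inv E0 A.

Definition Jtilde chi p : R :=
  \int[leb]_(x in Omega) frob (Einv chi x (p.1 x)) (p.2 x).

Definition gtilde chi p : R :=
  \int[leb]_(x in Omega)
    (frob (Einv chi x (p.1 x)) (p.1 x) + frob (Einv chi x (p.2 x)) (p.2 x)).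

(* The minimum of gtilde over S is written as the infimum of its values, which
   is the minimum as soon as a minimizer exists. *)
Definition penalized (lambda : R) (S : set ((V -> M) * (V -> M))) chi p : R :=
  Jtilde chi p + lambda * (gtilde chi p - inf [set gtilde chi q | q in S]).

End functionals.

End elasticity.

Definition argmin (T : Type) (R : realType) (F : T -> R) (S : set T) : set T :=
  [set p | S p /\ forall q, S q -> F p <= F q].

Definition is_minimum (R : realType) (A : set R) (m : R) :=
  A m /\ lbound A m.

(* Main.v *)
(* On symmetric L2 fields a(s, t) = int E^-1(chi) s : t is a symmetric positive
   semidefinite bilinear form, and S is a product of two affine spaces with the
   same direction V, the fields with zero load.  A minimizer (s, r) of
   a(s, s) + a(r, r) over S is a-orthogonal to V in both components, so for v, w
   in V the increment of J at (s + v, r + w) is a(v, w), while that of g is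
   a(v, v) + a(w, w) >= 2 |a(v, w)|; hence the penalty dominates once
   lambda > 1/2. *)
From HB Require Import structures.
Require Import Defs.
From mathcomp Require Import all_boot all_order all_algebra.
From mathcomp Require Import all_classical all_reals all_analysis.
From mathcomp Require Import measurable_realfun ring lra.

Set Implicit Arguments.
Unset Strict Implicit.
Unset Printing Implicit Defensive.
Import Order.TTheory GRing.Theory Num.Theory.
Import numFieldNormedType.Exports.
Local Open Scope classical_set_scope.
Local Open Scope ring_scope.

(** * Integrability and integrals over a set, through extension by zero *)

Section in_Lp_theory.
Context disp (T : measurableType disp) (R : realType).
Variables (mu : {measure set T -> \bar R}) (D : set T).
Implicit Types (p : \bar R) (f g : T -> R) (a : R).

Lemma in_Lp_ZD p a f g : (1 <= p)%E -> in_Lp mu p D f -> in_Lp mu p D g ->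
  in_Lp mu p D (fun x => a * f x + g x).
Proof.
move=> p1 fp gp; rewrite /in_Lp.
rewrite (_ : _ \_ D = a *: (f \_ D) + (g \_ D)).
  by case: (Lfun_submod_closed mu p1) => _; apply.
apply/funext => x.
rewrite [RHS](_ : _ = a * (f \_ D) x + (g \_ D) x)// !patchE.
by case: ifP => // _; rewrite mulr0 addr0.
Qed.

Lemma in_Lp0 p : (1 <= p)%E -> in_Lp mu p D (fun=> 0 : R).
Proof.
move=> p1; rewrite /in_Lp (_ : _ \_ D = 0); first by case: (Lfun_submod_closed mu p1).
by apply/funext => x; rewrite patchE; case: ifP.
Qed.

Lemma in_LpD p f g : (1 <= p)%E -> in_Lp mu p D f -> in_Lp mu p D g ->
  in_Lp mu p D (fun x => f x + g x).
Proof.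
by move=> p1 fp gp; have := in_Lp_ZD 1 p1 fp gp; under eq_fun do rewrite mul1r.
Qed.

Lemma in_LpZ p a f : (1 <= p)%E -> in_Lp mu p D f -> in_Lp mu p D (fun x => a * f x).
Proof.
move=> p1 fp; have := in_Lp_ZD a p1 fp (in_Lp0 p1).
by under eq_fun do rewrite addr0.
Qed.

Lemma in_Lp_sum p (I : Type) (s : seq I) (F : I -> T -> R) : (1 <= p)%E ->
  (forall i, in_Lp mu p D (F i)) -> in_Lp mu p D (fun x => \sum_(i <- s) F i x).
Proof.
move=> p1 Fp; elim: s => [|i s IHs].
  by under eq_fun do rewrite big_nil; exact: in_Lp0.
by under eq_fun do rewrite big_cons; exact: in_LpD.
Qed.

Lemma in_Lp2M f g : in_Lp mu 2%:E D f -> in_Lp mu 2%:E D g ->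
  in_Lp mu 1%E D (fun x => f x * g x).
Proof.
move=> f2 g2; rewrite /in_Lp (_ : _ \_ D = (f \_ D) \* (g \_ D)).
  exact: Lfun2_mul_Lfun1.
apply/funext => x; rewrite /= !patchE; case: ifP => // _; exact/esym/mulr0.
Qed.

Lemma measurable_in_Lp p f : in_Lp mu p D f -> measurable_fun setT (f \_ D).
Proof. by rewrite /in_Lp inE => /andP[/[!inE]]. Qed.

Lemma measurable_in_Lp_level p f a : in_Lp mu p D f ->
  measurable [set x | (f \_ D) x = a].
Proof.
move=> /measurable_in_Lp/(_ measurableT [set a] (measurable_set1 _)).
by rewrite setTI.
Qed.

(** Multiplication by a bounded measurable function preserves integrability. The affine factor is
    the shape taken by the coefficient of [Einv] once the design is replaced by an indicator. *)
Lemma in_Lp1_affine_indic (A : set T) a b f : measurable A ->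
  in_Lp mu 1%E D f -> in_Lp mu 1%E D (fun x => (a * \1_A x + b) * f x).
Proof.
move=> mA /Lfun1_integrable f1; apply/Lfun1_integrable.
rewrite (_ : EFin \o _ =
    (EFin \o (fun x => a * \1_A x + b)%R) \* (EFin \o f \_ D))%E; last first.
  apply/funext => x /=; rewrite !patchE -EFinM.
  by case: ifP => // _; congr EFin; rewrite mulr0.
apply: integrableMr => //.
  by apply: measurable_funD => //; apply: measurable_funM => //; exact: measurable_indic.
exists (`|a| + `|b|); split; first by rewrite num_real.
move=> M ltM x _; apply: le_trans (ltW ltM).
rewrite (le_trans (ler_normD _ _))// lerD2r normrM ler_piMr//.
by rewrite indicE; case: (x \in A); rewrite ?normr1 ?normr0.
Qed.

Lemma Rintegral_ZD a f g : in_Lp mu 1%E D f -> in_Lp mu 1%E D g ->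
  \int[mu]_(x in D) (a * f x + g x) =
  a * \int[mu]_(x in D) f x + \int[mu]_(x in D) g x.
Proof.
move=> /Lfun1_integrable f1 /Lfun1_integrable g1.
(* [in_Lp] speaks of the extension by zero, so all three integrals are first moved to the whole
   space. *)
rewrite Rintegral_mkcond [in X in _ = a * X + _]Rintegral_mkcond.
rewrite [in X in _ = _ + X]Rintegral_mkcond -RintegralZl// -RintegralD//.
  apply: eq_Rintegral => x _; rewrite !patchE.
  by case: ifP => // _; rewrite mulr0 addr0.
rewrite (_ : EFin \o _ = (fun x => a%:E * (EFin \o f \_ D) x)%E) //.
exact: integrableZl.
Qed.

Lemma aeS2 (P Q S : T -> Prop) : (forall x, P x -> Q x -> S x) ->
  {ae mu, forall x, P x} -> {ae mu, forall x, Q x} -> {ae mu, forall x, S x}.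
Proof. by move=> PQS; exact: filterS2. Qed.

Lemma aeS3 (P Q S U : T -> Prop) : (forall x, P x -> Q x -> S x -> U x) ->
  {ae mu, forall x, P x} -> {ae mu, forall x, Q x} -> {ae mu, forall x, S x} ->
  {ae mu, forall x, U x}.
Proof. by move=> PQSU; exact: filterS3. Qed.

Hypothesis cmu : measure_is_complete mu.

(** The two extensions differ only inside a null set, and completeness makes every subset of it
    measurable. *)
Lemma ae_measurable_restrict f g : {ae mu, forall x, D x -> f x = g x} ->
  measurable_fun setT (f \_ D) -> measurable_fun setT (g \_ D).
Proof.
move=> fg /measurable_EFinP mf; apply/measurable_EFinP.
apply: (ae_measurable_fun cmu) mf.
apply: filterS fg => x fgx _ /=; rewrite !patchE.
by case: ifPn => //; rewrite inE => /fgx ->.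
Qed.

Lemma ae_eq_Rintegral f g : measurable_fun setT (f \_ D) ->
  {ae mu, forall x, D x -> f x = g x} ->
  \int[mu]_(x in D) f x = \int[mu]_(x in D) g x.
Proof.
move=> mf fg; have mg := ae_measurable_restrict fg mf.
rewrite Rintegral_mkcond [RHS]Rintegral_mkcond.
congr fine; apply: ae_eq_integral => //; try exact/measurable_EFinP.
apply: filterS fg => x fgx _ /=; rewrite !patchE.
by case: ifPn => //; rewrite inE => /fgx ->.
Qed.

Lemma ae_in_Lp1 f g : {ae mu, forall x, D x -> f x = g x} ->
  in_Lp mu 1%E D f -> in_Lp mu 1%E D g.
Proof.
move=> fg f1; have mf := measurable_in_Lp f1.
have mg := ae_measurable_restrict fg mf.
apply/Lfun1_integrable; move/Lfun1_integrable : f1 => /integrableP[_ fi].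
apply/integrableP; split; first exact/measurable_EFinP.
rewrite (le_lt_trans _ fi)// le_eqVlt; apply/orP; left; apply/eqP.
apply: ae_eq_integral => //; try by apply: measurableT_comp => //; exact/measurable_EFinP.
apply: filterS fg => x fgx _ /=; rewrite !patchE.
by case: ifPn => //; rewrite inE => /fgx ->.
Qed.

Lemma ae_Rintegral_ge0 f : measurable_fun setT (f \_ D) ->
  {ae mu, forall x, D x -> 0 <= f x} -> 0 <= \int[mu]_(x in D) f x.
Proof.
(* The sign of [f] is known only a.e.; its absolute value is a representative that is nonnegative
   everywhere. *)
move=> mf f0; rewrite (@ae_eq_Rintegral f (fun x => `|f x|))//.
  by apply: Rintegral_ge0 => x _ /=.
by apply: filterS f0 => x f0x /f0x fx /=; rewrite ger0_norm.
Qed.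

End in_Lp_theory.

(** * Inversion of the elasticity tensor on symmetric matrices *)

Section elasticity_tensor_inverse.
Variables (R : realType) (d : nat).
Notation M := 'M[R]_d.
Implicit Types A B C : M.

Lemma frobC A B : frob A B = frob B A.
Proof. by apply: eq_bigr => i _; apply: eq_bigr => j _; exact: mulrC. Qed.

Lemma frobZDl a A B C : frob (a *: A + B) C = a * frob A C + frob B C.
Proof.
rewrite /frob mulr_sumr -big_split/=; apply: eq_bigr => i _.
rewrite mulr_sumr -big_split/=; apply: eq_bigr => j _.
by rewrite !mxE mulrDl mulrA.
Qed.

Lemma frob0l A : frob 0 A = 0.
Proof. by apply: big1 => i _; apply: big1 => j _; rewrite mxE mul0r. Qed.

Lemma frobZl a A B : frob (a *: A) B = a * frob A B.
Proof. by rewrite -[a *: A]addr0 frobZDl frob0l addr0. Qed.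

Lemma symmetric_mxZD a A B : symmetric_mx A -> symmetric_mx B ->
  symmetric_mx (a *: A + B).
Proof. by rewrite /symmetric_mx => Asym Bsym; rewrite linearD linearZ/= Asym Bsym. Qed.

Definition sym_part A : M := 2^-1 *: (A + A^T).

Lemma sym_part_is_linear : linear sym_part.
Proof.
by move=> a A B; apply/matrixP => i j; rewrite !mxE; ring.
Qed.

HB.instance Definition _ :=
  GRing.isLinear.Build R M M *:%R sym_part sym_part_is_linear.

Lemma symmetric_sym_part A : symmetric_mx (sym_part A).
Proof. by rewrite /symmetric_mx /sym_part linearZ/= linearD/= trmxK addrC. Qed.

Lemma sym_part_id A : symmetric_mx A -> sym_part A = A.
Proof.
move=> Asym; rewrite /sym_part Asym.
by apply/matrixP => i j; rewrite !mxE; lra.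
Qed.

Lemma sym_partK A : sym_part (A - sym_part A) = 0.
Proof. by rewrite linearB/= (sym_part_id (symmetric_sym_part A)) subrr. Qed.

Variable E0 : {linear M -> M}.
Hypothesis E0_elastic : elasticity_tensor E0.

(** Otherwise [A - B] would be a nonzero symmetric matrix sent to 0 by [E0], against positive
    definiteness. *)
Lemma elasticity_tensor_inj A B : symmetric_mx A -> symmetric_mx B ->
  E0 A = E0 B -> A = B.
Proof.
move=> Asym Bsym EAB; have [_ _ E0_gt0] := E0_elastic.
apply/eqP; rewrite -subr_eq0; apply/negPn/negP => AB0.
have ABsym : symmetric_mx (A - B).
  by rewrite addrC -scaleN1r; exact: symmetric_mxZD.
have := E0_gt0 _ ABsym AB0; rewrite linearB/= EAB subrr.
by rewrite frob0l ltxx.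
Qed.

(* [E0] is only controlled on symmetric matrices; adding the skew part makes it
   injective, hence bijective, on all matrices. *)
Definition elastic_ext A : M := E0 (sym_part A) + (A - sym_part A).

Lemma elastic_ext_is_linear : linear elastic_ext.
Proof.
move=> a A B; rewrite /elastic_ext sym_part_is_linear (linearP E0).
by apply/matrixP => i j; rewrite !mxE; ring.
Qed.

HB.instance Definition _ :=
  GRing.isLinear.Build R M M *:%R elastic_ext elastic_ext_is_linear.

(** The term [A - sym_part A] is skew and [E0] preserves symmetry, so taking the symmetric part
    isolates the [E0] term. *)
Lemma sym_part_elastic_ext A : sym_part (elastic_ext A) = E0 (sym_part A).
Proof.
have [E0_sym _ _] := E0_elastic.
rewrite /elastic_ext linearD/= sym_partK addr0 sym_part_id//.
exact/E0_sym/symmetric_sym_part.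
Qed.

(** [tensor_inv] is a pointwise choice without visible structure. An injective endomorphism of a
    finite-dimensional space is bijective, so inverting [elastic_ext] gives one linear map that
    agrees with [tensor_inv] on symmetric matrices; integrability and bilinearity of the energy rest
    on it. *)
Lemma tensor_inv_linear : exists C : {linear M -> M}, forall A, symmetric_mx A ->
  [/\ symmetric_mx (C A), E0 (C A) = A & tensor_inv E0 A = C A].
Proof.
have [E0_sym _ _] := E0_elastic.
have ext_inj : lker (linfun elastic_ext) == 0%VS.
  apply/lker0P => A B; rewrite !lfunE/= => AB.
  have sAB : sym_part A = sym_part B.
    apply: elasticity_tensor_inj; [exact: symmetric_sym_part..|].
    by rewrite -!sym_part_elastic_ext AB.
  by move: AB; rewrite /elastic_ext sAB => /addrI/addIr.
exists ((linfun elastic_ext)^-1)%VF => A Asym.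
suff inv_ext B : elastic_ext B = A ->
    [/\ symmetric_mx B, E0 B = A & tensor_inv E0 A = B].
  by apply: inv_ext; have := lker0_lfunVK ext_inj A; rewrite lfunE.
move=> EB.
have EsB : E0 (sym_part B) = A by rewrite -sym_part_elastic_ext EB sym_part_id.
(* [E0 (sym_part B)] is already [A], so the skew remainder [B - sym_part B] must vanish. *)
have Bsym : sym_part B = B.
  move: EB; rewrite /elastic_ext EsB => /eqP.
  by rewrite -subr_eq0 addrAC subrr add0r subr_eq0 => /eqP.
split; [rewrite -Bsym; exact: symmetric_sym_part|by rewrite -[in LHS]Bsym|].
apply: xget_subset1; first by split; rewrite -Bsym//; exact: symmetric_sym_part.
by move=> X Y [Xs EX] [Ys EY]; apply: elasticity_tensor_inj => //; rewrite EX EY.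
Qed.

End elasticity_tensor_inverse.

Lemma leb_is_complete (R : realType) (d : nat) : measure_is_complete (@leb R d).
Proof. exact: measure_is_complete_caratheodory. Qed.

(** * Square integrable stress fields and the energy form *)

Section square_integrable_matrix_fields.
Variables (R : realType) (d : nat) (Omega : set 'rV[R]_d).
Notation V := 'rV[R]_d.
Notation M := 'M[R]_d.
Implicit Types s t : V -> M.

Lemma L2mx_ZD a s t : L2mx Omega s -> L2mx Omega t ->
  L2mx Omega (fun x => a *: s x + t x).
Proof.
move=> s2 t2 i j; under eq_fun do rewrite !mxE.
by apply: in_Lp_ZD => //; exact: lee1n.
Qed.

(** Expanding [s x] in the basis [delta_mx k l] makes each entry of [C (s x)] a finite combination,
    with constant coefficients, of entries of [s x]. *)
Lemma L2mx_linear (C : {linear M -> M}) s : L2mx Omega s ->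
  L2mx Omega (fun x => C (s x)).
Proof.
move=> s2 i j.
rewrite (_ : (fun x => _) =
    fun x => \sum_k \sum_l C (delta_mx k l) i j * s x k l).
  apply: in_Lp_sum => [|k]; first exact: lee1n.
  apply: in_Lp_sum => [|l]; first exact: lee1n.
  by apply: in_LpZ => //; exact: lee1n.
apply/funext => x; rewrite {1}(matrix_sum_delta (s x)) linear_sum summxE.
apply: eq_bigr => k _; rewrite linear_sum summxE; apply: eq_bigr => l _.
by rewrite linearZ mxE mulrC.
Qed.

Lemma in_Lp1_frob s t : L2mx Omega s -> L2mx Omega t ->
  in_Lp leb 1%E Omega (fun x => frob (s x) (t x)).
Proof.
move=> s2 t2; apply: in_Lp_sum => // i; apply: in_Lp_sum => // j.
exact: in_Lp2M.
Qed.

Definition symmetric_L2mx s := L2mx Omega s /\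
  {ae leb, forall x, Omega x -> symmetric_mx (s x)}.

Lemma symmetric_L2mx_ZD a s t : symmetric_L2mx s -> symmetric_L2mx t ->
  symmetric_L2mx (a *: s + t).
Proof.
move=> [s2 ssym] [t2 tsym]; split; first exact: L2mx_ZD.
by apply: aeS2 ssym tsym => x sx tx Ox; apply: symmetric_mxZD; auto.
Qed.

Section energy.
Variables (E0 : {linear M -> M}) (Emax Emin : R) (chi : V -> R).
Hypothesis E0_elastic : elasticity_tensor E0.
Hypotheses (Emax_gt0 : 0 < Emax) (Emin_gt0 : 0 < Emin).
Hypothesis chi_L1 : in_Lp leb 1%E Omega chi.
Hypothesis chi01 : {ae leb, forall x, Omega x -> chi x = 0 \/ chi x = 1}.

Definition energy_density s t (x : V) : R :=
  frob (Einv E0 Emax Emin chi x (s x)) (t x).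

(** [Jtilde] at [p] is convertible to [energy p.1 p.2], so only [gtilde] gets a rewriting lemma. *)
Definition energy s t : R := \int[leb]_(x in Omega) energy_density s t x.

(** Up to null sets the design is an indicator and [tensor_inv] is linear, so the density is a
    bounded factor times a Frobenius product of square integrable fields. *)
Lemma in_Lp1_energy_density s t : symmetric_L2mx s -> symmetric_L2mx t ->
  in_Lp leb 1%E Omega (energy_density s t).
Proof.
move=> [s2 ssym] [t2 tsym].
have [C C_inv] := tensor_inv_linear E0_elastic.
(* [chi] takes values in {0, 1} only a.e. and may be unbounded on a null set; the indicator of [A]
   is a bounded substitute. *)
pose A := [set x | (chi \_ Omega) x = 1].
have mA := measurable_in_Lp_level 1 chi_L1; rewrite -/A in mA.
apply: (ae_in_Lp1 (@leb_is_complete R d) (f := fun x =>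
    ((Emax^-1 - Emin^-1) * \1_A x + Emin^-1) * frob (C (s x)) (t x))).
  apply: aeS2 chi01 ssym => x chix sx Ox.
  rewrite /energy_density /Einv frobZl.
  have [_ _ ->] := C_inv _ (sx Ox).
  congr ((_ * _ + _) * _); rewrite indicE.
  have -> : (x \in A) = (chi x == 1).
    by apply/idP/eqP; rewrite inE /A/= patchE mem_set.
  by case: (chix Ox) => ->; rewrite ?eqxx// eq_sym oner_eq0.
by apply: in_Lp1_affine_indic => //; apply: in_Lp1_frob => //; exact: L2mx_linear.
Qed.

(** Self-adjointness passes to the inverse: [C s : t = C s : E0 (C t) = E0 (C s) : C t = s : C
    t]. *)
Lemma energyC s t : symmetric_L2mx s -> symmetric_L2mx t -> energy s t = energy t s.
Proof.
move=> sX tX; have [C C_inv] := tensor_inv_linear E0_elastic.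
have [_ E0_selfadj _] := E0_elastic.
apply: ae_eq_Rintegral; first exact: leb_is_complete.
  exact: measurable_in_Lp (in_Lp1_energy_density sX tX).
apply: aeS2 sX.2 tX.2 => x sx tx Ox.
rewrite /energy_density /Einv !frobZl.
have [Cs_sym ECs ->] := C_inv _ (sx Ox); have [Ct_sym ECt ->] := C_inv _ (tx Ox).
by congr (_ * _); rewrite -{1}ECt -E0_selfadj// ECs frobC.
Qed.

Lemma energy_ge0 s : symmetric_L2mx s -> 0 <= energy s s.
Proof.
move=> sX; have [C C_inv] := tensor_inv_linear E0_elastic.
have [_ _ E0_gt0] := E0_elastic.
apply: ae_Rintegral_ge0; first exact: leb_is_complete.
  exact: measurable_in_Lp (in_Lp1_energy_density sX sX).
apply: aeS2 sX.2 chi01 => x sx chix Ox.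
rewrite /energy_density /Einv frobZl.
have [Cs_sym ECs ->] := C_inv _ (sx Ox).
apply: mulr_ge0.
  (* The coefficient is [Emin^-1] where [chi] is 0 and [Emax^-1] where it is 1. *)
  by case: (chix Ox) => ->; rewrite ?mulr0 ?mulr1 ?subrK ?add0r invr_ge0 ltW.
(* With [s = E0 (C s)] the product becomes the quadratic form of [E0] at [C s]. *)
rewrite -{2}ECs frobC; have [->|Cs0] := eqVneq (C (s x)) 0.
  by rewrite frobC frob0l.
exact/ltW/E0_gt0.
Qed.

(** [tensor_inv] is known to be linear only on symmetric matrices, so the densities are compared
    a.e., where all three fields are symmetric. *)
Lemma energyZD a s1 s2 t : symmetric_L2mx s1 -> symmetric_L2mx s2 ->
  symmetric_L2mx t ->
  energy (a *: s1 + s2) t = a * energy s1 t + energy s2 t.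
Proof.
move=> s1X s2X tX; have [C C_inv] := tensor_inv_linear E0_elastic.
have s12X := symmetric_L2mx_ZD a s1X s2X.
rewrite -Rintegral_ZD; [|exact: in_Lp1_energy_density..].
apply: ae_eq_Rintegral; first exact: leb_is_complete.
  exact: measurable_in_Lp (in_Lp1_energy_density s12X tX).
apply: aeS3 s1X.2 s2X.2 s12X.2 => x s1x s2x s12x Ox.
rewrite /energy_density /Einv !frobZl.
have [_ _ ->] := C_inv _ (s1x Ox); have [_ _ ->] := C_inv _ (s2x Ox).
have [_ _ ->] := C_inv _ (s12x Ox).
rewrite [C _](_ : _ = a *: C (s1 x) + C (s2 x)); last exact: (linearP C).
by rewrite frobZDl; ring.
Qed.

Lemma gtilde_energy p : symmetric_L2mx p.1 -> symmetric_L2mx p.2 ->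
  gtilde E0 Emax Emin Omega chi p = energy p.1 p.1 + energy p.2 p.2.
Proof.
move=> p1X p2X; rewrite -[X in X + _]mul1r -Rintegral_ZD;
  [|exact: in_Lp1_energy_density..].
by apply: eq_Rintegral => x _; rewrite mul1r.
Qed.

End energy.

End square_integrable_matrix_fields.

(** * Stress fields in equilibrium with a load *)

Section admissible_stresses.
Variables (R : realType) (d : nat) (Omega GammaD GammaN : set 'rV[R]_d).
Notation V := 'rV[R]_d.
Notation M := 'M[R]_d.

(** One factor of [stress_pairs], with an arbitrary load functional: the zero load then gives the
    common direction of both factors. *)
Definition admissible (load : (V -> V) -> R) (s : V -> M) :=
  symmetric_L2mx Omega s /\ forall w, H1D Omega GammaD w ->
    \int[leb]_(x in Omega) frob (s x) (strain Omega w x) = load w.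

Lemma weak_gradP u : H1 Omega u -> is_weak_grad Omega u (weak_grad Omega u).
Proof. by move=> [_ gradu]; exact: (xgetPex (fun=> 0) gradu). Qed.

Lemma L2mx_strain w : (forall i, H1 Omega (component w i)) ->
  L2mx Omega (strain Omega w).
Proof.
move=> wH1.
have jac2 i j : in_Lp leb 2%:E Omega (fun x => jacobian_mx Omega w x i j).
  under eq_fun do rewrite mxE.
  exact: (weak_gradP (wH1 i) j).1.
have tr2 : L2mx Omega (fun x => (jacobian_mx Omega w x)^T).
  by move=> i j; under eq_fun do rewrite mxE; exact: jac2.
move=> i j; rewrite (_ : (fun x => _) =
    fun x => 2^-1 * (jacobian_mx Omega w x i j + jacobian_mx Omega w x j i)).
  apply: in_LpZ; first exact: lee1n.
  by apply: in_LpD; [exact: lee1n|exact: jac2..].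
by apply/funext => x; rewrite /strain !mxE.
Qed.

(** The virtual work is linear in the stress because its integrand is integrable. Tracking the load
    serves both to translate by a zero-load field and to subtract two fields of equal load. *)
Lemma admissibleZD a (l k : (V -> V) -> R) (s t : V -> M) :
  admissible l s -> admissible k t ->
  admissible (fun w => a * l w + k w) (a *: s + t).
Proof.
move=> [sX sl] [tX tk]; split; first exact: symmetric_L2mx_ZD.
move=> w wH; have w2 := L2mx_strain wH.1.
rewrite -(sl w wH) -(tk w wH) -Rintegral_ZD.
- by apply: eq_Rintegral => x _; rewrite -frobZDl.
- by apply: in_Lp1_frob => //; exact: sX.1.
- by apply: in_Lp1_frob => //; exact: tX.1.
Qed.

Lemma stress_pairsP (qin qout : V -> V) p :
  stress_pairs Omega GammaD GammaN qin qout p <->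
  admissible (fun w => \int[surf]_(x in GammaN) dot (qin x) (trace_vec Omega w x)) p.1 /\
  admissible (fun w => \int[surf]_(x in GammaN) dot (qout x) (trace_vec Omega w x)) p.2.
Proof.
split=> [[p12 p22 p1s p2s eqn]|[[[p12 p1s] eqn1] [[p22 p2s] eqn2]]].
  by split; split => // w /eqn[].
by split=> // w wH; split; [exact: eqn1|exact: eqn2].
Qed.

End admissible_stresses.

(** * Exactness of the penalty, in an abstract vector space *)

(** The properties of [a] are asked on [X] only, since the energy is a bilinear form just on
    symmetric square integrable fields. [K1] and [K2] stand for the two affine spaces and [V] for
    their direction. *)
Lemma penalty_exact (R : realType) (W : lmodType R) (V K1 K2 X : set W)
    (a : W -> W -> R) (lambda : R) (s r : W) :
  V `<=` X -> K1 `<=` X -> K2 `<=` X ->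
  (forall c v x, V v -> K1 x -> K1 (c *: v + x)) ->
  (forall c v x, V v -> K2 x -> K2 (c *: v + x)) ->
  (forall x y, K1 x -> K1 y -> V (y - x)) ->
  (forall x y, K2 x -> K2 y -> V (y - x)) ->
  (forall c x y, X x -> X y -> X (c *: x + y)) ->
  (forall c x y z, X x -> X y -> X z -> a (c *: x + y) z = c * a x z + a y z) ->
  (forall x y, X x -> X y -> a x y = a y x) ->
  (forall x, X x -> 0 <= a x x) ->
  2^-1 < lambda ->
  K1 s -> K2 r ->
  (forall s' r', K1 s' -> K2 r' -> a s s + a r r <= a s' s' + a r' r') ->
  forall s' r', K1 s' -> K2 r' ->
  a s r <= a s' r' + lambda * (a s' s' + a r' r' - (a s s + a r r)).
Proof.
move=> VX K1X K2X K1V K2V VK1 VK2 XZD aZD aC a_ge0 lambda12 Ks Kr smin s' r' Ks' Kr'.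
have aDZ c x y z : X x -> X y -> X z -> a z (c *: x + y) = c * a z x + a z y.
  by move=> Xx Xy Xz; rewrite aC ?aZD 1?(aC x) 1?(aC y)//; exact: XZD.
have quad c v x : X v -> X x ->
    a (c *: v + x) (c *: v + x) = c ^+ 2 * a v v + 2 * c * a x v + a x x.
  move=> Xv Xx; rewrite aZD ?aDZ//; last exact: XZD.
  by rewrite (aC v x)//; ring.
have orth x v : X x -> X v -> (forall c, a x x <= a (c *: v + x) (c *: v + x)) ->
    a x v = 0.
  move=> Xx Xv xmin; apply/eqP/negPn/negP => xv0.
  have vv0 := a_ge0 v Xv.
  (* The form is only semidefinite, so [a v v] may be 0; adding 1 keeps the denominator positive. At
     this [c] the quadratic equals [a x x - e ^+ 2 * (a v v + 2)], below its assumed minimum. *)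
  have := xmin (- a x v / (a v v + 1)); rewrite quad//.
  have v1 : 0 < a v v + 1 by lra.
  set e := a x v / (a v v + 1).
  have xvE : a x v = e * (a v v + 1) by rewrite /e divfK// gt_eqF.
  have e0 : e != 0 by apply: contra_neq xv0 => e0; rewrite xvE e0 mul0r.
  rewrite mulNr -/e xvE.
  have : 0 < e ^+ 2 * (a v v + 2).
    by rewrite mulr_gt0 ?exprn_even_gt0//; lra.
  by move: (a v v) (a x x) => A B; lra.
have Xs := K1X _ Ks; have Xr := K2X _ Kr.
(* Only the first component varies, so the [a r r] terms cancel and [s] alone is a minimizer along
   [v]. *)
have sV v : V v -> a s v = 0.
  move=> Vv; apply: orth => [//||c]; first exact: VX.
  by have := smin _ _ (K1V c _ _ Vv Ks) Kr; rewrite lerD2r.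
have rV v : V v -> a r v = 0.
  move=> Vv; apply: orth => [//||c]; first exact: VX.
  by have := smin _ _ Ks (K2V c _ _ Vv Kr); rewrite lerD2l.
have Vv := VK1 _ _ Ks Ks'; have Vw := VK2 _ _ Kr Kr'.
have -> : s' = 1 *: (s' - s) + s by rewrite scale1r subrK.
have -> : r' = 1 *: (r' - r) + r by rewrite scale1r subrK.
move: (s' - s) (r' - r) Vv Vw => v w Vv Vw.
have Xv := VX _ Vv; have Xw := VX _ Vw.
rewrite !quad// aZD//; last exact: XZD.
rewrite !aDZ// (aC v r)// (sV v)// (sV w)// (rV v)// (rV w)//.
(* What remains is [0 <= a v w + lambda * (a v v + a w w)]. Nonnegativity of [a] at [v + w] bounds
   [a v w] below by [- (a v v + a w w) / 2], and [lambda] exceeds 1/2. *)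
have := a_ge0 _ Xv; have := a_ge0 _ Xw.
have := a_ge0 _ (XZD 1 _ _ Xv Xw); rewrite quad// (aC w v)//.
have : 0 < lambda - 2^-1 by rewrite subr_gt0.
move: (a v v) (a v w) (a w w) (a s s) (a s r) (a r r) => A B C D E F; nra.
Qed.

Theorem theorem2p3 (R : realType) (d : nat)
  (Omega GammaD GammaN : set 'rV[R]_d) (qin qout : 'rV[R]_d -> 'rV[R]_d)
  (E0 : {linear 'M[R]_d -> 'M[R]_d}) (Emax Emin beta lambda : R)
  (chi : 'rV[R]_d -> R)
  (sr : ('rV[R]_d -> 'M[R]_d) * ('rV[R]_d -> 'M[R]_d)) :
  let S := stress_pairs Omega GammaD GammaN qin qout in
  (0 < d)%N ->
  bounded_lipschitz_domain Omega ->
  bdry Omega = closure GammaD `|` closure GammaN ->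
  GammaD `&` GammaN = set0 ->
  (@hausdorff_outer R d d.-1).-cara.-measurable GammaD ->
  (@hausdorff_outer R d d.-1).-cara.-measurable GammaN ->
  (0 < surf GammaD)%E ->
  L2vec surf GammaN qin ->
  L2vec surf GammaN qout ->
  elasticity_tensor E0 ->
  0 < Emax -> 0 < Emin ->
  0 < beta < 1 ->
  designs Omega beta chi ->
  1 / 2 < lambda ->
  argmin (gtilde E0 Emax Emin Omega chi) S sr ->
  is_minimum
    [set penalized E0 Emax Emin Omega lambda S chi p | p in S]
    (Jtilde E0 Emax Emin Omega chi sr).
Proof.
move=> S _ _ _ _ _ _ _ _ _ E0_elastic Emax0 Emin0 _ [[chi1 _] chi01 _] lambda12.
move=> [Ssr srmin].
(* The infimum inside [penalized] is attained at [sr], so the penalty vanishes there. *)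
have inf_g : inf [set gtilde E0 Emax Emin Omega chi q | q in S] =
    gtilde E0 Emax Emin Omega chi sr.
  apply/eqP; rewrite eq_le; apply/andP; split.
    apply: ge_inf; last by exists sr.
    by exists (gtilde E0 Emax Emin Omega chi sr) => _ [q Sq <-]; exact: srmin.
  apply: lb_le_inf; first by exists (gtilde E0 Emax Emin Omega chi sr); exists sr.
  by move=> _ [q Sq <-]; exact: srmin.
split.
  by exists sr => //; rewrite /penalized inf_g subrr mulr0 addr0.
move=> _ [[s r] Ssr' <-]; rewrite /penalized inf_g.
have /stress_pairsP[Ks Kr] := Ssr; have /stress_pairsP[Ks' Kr'] := Ssr'.
rewrite !(@gtilde_energy _ _ _ E0); try by [|case: Ks|case: Kr|case: Ks'|case: Kr'].
have KV (l : ('rV[R]_d -> 'rV[R]_d) -> R) c v x :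
    admissible Omega GammaD (fun=> 0) v -> admissible Omega GammaD l x ->
    admissible Omega GammaD l (c *: v + x).
  move=> Kv Kx; have := admissibleZD c Kv Kx.
  by under eq_fun do rewrite mulr0 add0r.
have VK (l : ('rV[R]_d -> 'rV[R]_d) -> R) x y :
    admissible Omega GammaD l x -> admissible Omega GammaD l y ->
    admissible Omega GammaD (fun=> 0) (y - x).
  move=> Kx Ky; have := admissibleZD (-1) Kx Ky.
  by under eq_fun do rewrite mulN1r addNr; rewrite scaleN1r addrC.
apply: (@penalty_exact R _ (admissible Omega GammaD (fun=> 0))
  (admissible Omega GammaD _) (admissible Omega GammaD _)
  (symmetric_L2mx Omega) (energy Omega E0 Emax Emin chi)) (Ks) (Kr) _ _ _ (Ks') (Kr').
- by move=> ? [].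
- by move=> ? [].
- by move=> ? [].
- by move=> c v x; exact: KV.
- by move=> c v x; exact: KV.
- by move=> x y; exact: VK.
- by move=> x y; exact: VK.
- exact: symmetric_L2mx_ZD.
- by move=> *; exact: energyZD.
- by move=> *; exact: energyC.
- by move=> *; exact: energy_ge0.
- by rewrite -div1r.
(* Minimality of [sr] for [gtilde], read through [gtilde_energy]. *)
- move=> s' r' Ks1 Kr1; have := srmin (s', r').
  rewrite !(@gtilde_energy _ _ _ E0)//=; try by [|case: Ks|case: Kr|case: Ks1|case: Kr1].
  by apply; apply/stress_pairsP.
Qed.
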